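(* Let $M=\langle S,A,T,R,\gamma\rangle$ be a finite MDP and $\phi:S\to\bar S$ a surjective state abstraction function. Suppose an agent collects data by acting in $M$ according to a policy $\bar\pi$, observing only the abstract states $\phi(s)$. Let $(\bar s,a)\in\bar S\times A$ be any abstract state-action pair, let $N(\bar s,a)\ge 1$ be a fixed number of samples collected for this pair, and let $\epsilon>0$. Then, with probability at least $1-\delta$, where $\delta=2^{|\bar S|}e^{-\frac18 N(\bar s,a)\epsilon^2}$, $$\|\bar T_Y(\cdot|\bar s,a)-\bar T_{\omega_X}(\cdot|\bar s,a)\|_1\le\epsilon .$$
   Context: $M=\langle S,A,T,R,\gamma\rangle$ is an MDP with finite state set $S$, finite action set $A$, and transition probabilities $T(s'|s,a)$. $\phi:S\to\bar S$ is surjective; an abstract state $\bar s$ is identified with the set $\{s\in S:\phi(s)=\bar s\}$, and $T(\bar s'|s,a)=\sum_{s'\in\bar s'}T(s'|s,a)$. The agent observes only $\phi(s)$, and its policy $\bar\pi$ selects actions from the observed abstract information (it may change over time, i.e. depend on the observed history). The true states evolve by $s_{t+1}\sim T(\cdot|s_t,a_t)$. For a fixed pair $(\bar s,a)$, write $n=N(\bar s,a)$ and let $\tau_1<\tau_2<\dots<\tau_n$ be the first $n$ time steps at which the agent took action $a$ while in a state belonging to $\bar s$ (these $n$ visits are assumed to occur). Let $X^{(i)}_{\bar s,a}=s_{\tau_i}\in\bar s$ be the (unobserved) true state at the $i$-th such time, and $\bar Y^{(i)}_{\bar s,a}=\phi(s_{\tau_i+1})$ the abstract next state. For $\bar s'\in\bar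 S$ the empirical abstract transition function is $$\bar T_Y(\bar s'|\bar s,a)=\frac1n\sum_{i=1}^{n}\mathbb 1\{\bar Y^{(i)}_{\bar s,a}=\bar s'\}.$$ The (random) empirical weighting is $\omega_X(s,a)=\frac1n\sum_{i=1}^n\mathbb 1\{X^{(i)}_{\bar s,a}=s\}$ for $s\in\bar s$, and $$\bar T_{\omega_X}(\bar s'|\bar s,a)=\sum_{s\in\bar s}\omega_X(s,a)\sum_{s'\in\bar s'}T(s'|s,a).$$ $\|p-q\|_1=\sum_{\bar s'\in\bar S}|p(\bar s')-q(\bar s')|$. *)

(* Defs.v *)
From HB Require Import structures.
From mathcomp Require Import all_boot all_order all_algebra.
From mathcomp Require Import all_classical all_reals all_analysis.

Set Implicit Arguments.
Unset Strict Implicit.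
Unset Printing Implicit Defensive.

Import Order.TTheory GRing.Theory Num.Theory.
Local Open Scope classical_set_scope.
Local Open Scope ring_scope.

Definition is_dist (R : realType) (I : finType) (p : I -> R) : Prop :=
  (forall i, 0 <= p i) /\ \sum_i p i = 1.

(* [mdp_trans M s a s'] is T(s'|s,a). *)
Record mdp (R : realType) (S A : finType) := Mdp {
  mdp_trans : S -> A -> S -> R;
  mdp_reward : S -> A -> R;
  mdp_discount : R;
  mdp_transP : forall s a, is_dist (mdp_trans s a);
  mdp_discountP : 0 <= mdp_discount <= 1 }.

(* A randomized, history-dependent policy that only sees abstract states:
   [policy_prob pi h sb a] is the probability of choosing a when the current
   abstract state is sb and h lists the earlier (abstract state, action) pairs,
   oldest first. *)
Record policy (R : realType) (Sb A : finType) := Policy {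
  policy_prob : seq (Sb * A) -> Sb -> A -> R;
  policy_probP : forall h sb, is_dist (policy_prob h sb) }.

Section Process.
Context {R : realType} {S A Sb : finType} (M : mdp R S A) (phi : S -> Sb).

(* T(sb'|s,a) *)
Definition abs_trans (sb' : Sb) (s : S) (a : A) : R :=
  \sum_(s' | phi s' == sb') mdp_trans M s a s'.

Definition abs_history (x : nat -> S) (u : nat -> A) (t : nat) : seq (Sb * A) :=
  [seq (phi (x k), u k) | k <- iota 0 t].

Context {d : measure_display} {Omega : measurableType d}.
Variables (P : probability Omega R) (st : nat -> Omega -> S)
  (ac : nat -> Omega -> A).

(* The event s_0 = x_0, a_0 = u_0, ..., a_(t-1) = u_(t-1), s_t = x_t; only
   finitely many values of x and u matter. *)
Definition traj_event (x : nat -> S) (u : nat -> A) (t : nat) : set Omega :=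
  [set w | (forall k, (k <= t)%N -> st k w = x k) /\
           (forall k, (k < t)%N -> ac k w = u k)].

(* The process (s_t, a_t) is generated by acting in M according to pi, from an
   arbitrary initial distribution. The two conditional laws, a_t given the past
   up to s_t and s_(t+1) given the past up to a_t, are written in product form,
   so that past events of probability 0 need no convention. *)
Record generated_by (pi : policy R Sb A) : Prop := GeneratedBy {
  gen_measurable_st : forall t s, measurable (st t @^-1` [set s]);
  gen_measurable_ac : forall t a, measurable (ac t @^-1` [set a]);
  gen_action : forall x u t,
    P (traj_event x u t `&` ac t @^-1` [set u t]) =
    (P (traj_event x u t) *
     (policy_prob pi (abs_history x u t) (phi (x t)) (u t))%:E)%E;
  gen_state : forall x u t,
    P (traj_event x u t `&` ac t @^-1` [set u t]
       `&` st t.+1 @^-1` [set x t.+1]) =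
    (P (traj_event x u t `&` ac t @^-1` [set u t]) *
     (mdp_trans M (x t) (u t) (x t.+1))%:E)%E }.

Variables (sb : Sb) (a : A).

Definition visit (t : nat) (w : Omega) : bool :=
  (phi (st t w) == sb) && (ac t w == a).

(* number of visits strictly before time t *)
Definition nvisits (t : nat) (w : Omega) : nat := (\sum_(k < t) visit k w)%N.

(* Time of visit number i, counting from i = 0, so this is tau_(i+1); the time
   is unique when it exists, and the value is the junk 0 when it does not. *)
Definition visit_time (i : nat) (w : Omega) : nat :=
  xget 0%N [set t | visit t w /\ nvisits t w = i].

Definition visit_state (i : nat) (w : Omega) : S := st (visit_time i w) w.

Definition visit_next (i : nat) (w : Omega) : Sb :=
  phi (st (visit_time i w).+1 w).

Variable n : nat.

(* \bar T_Y(sb'|sb,a) *)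
Definition emp_trans (w : Omega) (sb' : Sb) : R :=
  n%:R^-1 * \sum_(i < n) (visit_next i w == sb')%:R.

(* omega_X(s,a) *)
Definition emp_weight (w : Omega) (s : S) : R :=
  n%:R^-1 * \sum_(i < n) (visit_state i w == s)%:R.

(* \bar T_(omega_X)(sb'|sb,a) *)
Definition weighted_trans (w : Omega) (sb' : Sb) : R :=
  \sum_(s | phi s == sb) emp_weight w s * abs_trans sb' s a.

End Process.

Definition l1_dist (R : realType) (I : finType) (p q : I -> R) : R :=
  \sum_i `|p i - q i|.

(* Main.v *)
Require Import Defs.
From HB Require Import structures.
From mathcomp Require Import all_boot all_order all_algebra.
From mathcomp Require Import all_classical all_reals all_analysis.
From mathcomp Require Import ring lra.

Set Implicit Arguments.
Unset Strict Implicit.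
Unset Printing Implicit Defensive.

Import Order.TTheory GRing.Theory Num.Theory.
Import numFieldNormedType.Exports.
Local Open Scope classical_set_scope.
Local Open Scope ring_scope.

(* The L1 distance is the largest value, over sign vectors h on the abstract
   states, of the sum of h times the difference of the two distributions. For a
   fixed h this is 2 / n times the sum, over the first n visits, of the
   increments (h(phi(s_(t+1))) - E[h(phi(s_(t+1))) | s_t, a_t = a]) / 2, which
   are centered given the past and lie in [-1, 1]. By Hoeffding's lemma the
   exponential of c times the partial sum over the visits before time t, with a
   compensation of c^2 / 2 per visit, is a supermartingale in real time t; so
   Markov's inequality applies at each deterministic time, with no need for the
   strong Markov property at the random visit times. A union bound over the
   2^|Sb| sign vectors, and then t -> oo, conclude. *)

(** * Hoeffding's lemma for a finite distribution *)

Lemma ger0_is_derive_le (R : realType) (f f' : R -> R) (x : R) :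
  (forall y : R, is_derive (y : R) (1 : R) f (f' y)) ->
  (forall y, 0 <= y -> 0 <= f' y) ->
  0 <= x -> f 0 <= f x.
Proof.
move=> df f'ge0 x_ge0; apply: (@ger0_derive1_le_cc _ f 0 x) => //.
- move=> y; rewrite in_itv /= => /andP[y_gt0 _].
  by rewrite derive1E (@derive_val _ _ _ _ _ _ _ (df y)) f'ge0 // ltW.
- by apply: derivable_within_continuous => y _; case: (df y).
- by rewrite in_itv /= lexx.
- by rewrite in_itv /= x_ge0 lexx.
Qed.

(** The difference of the two sides vanishes at 0 and has derivative [y * (expR y - expR (- y))],
    nonnegative for [y >= 0]. *)
Lemma sinh_le_mul_cosh (R : realType) (x : R) : 0 <= x ->
  expR x - expR (- x) <= x * (expR x + expR (- x)).
Proof.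
move=> x_ge0.
pose f (y : R) := y * (expR y + expR (- y)) - (expR y - expR (- y)).
have df y : is_derive (y : R) (1 : R) f (y * (expR y - expR (- y))).
  by apply: is_derive_eq; rewrite /GRing.scale /=; ring.
have := ger0_is_derive_le df _ x_ge0.
rewrite /f mul0r oppr0 subrr subrr subr_ge0; apply => y y_ge0.
by rewrite mulr_ge0 // subr_ge0 ler_expR; lra.
Qed.

(** The product of [cosh y] and [expR (- (y ^+ 2 / 2))] is nonincreasing on [y >= 0], by
    [sinh_le_mul_cosh], and equals 1 at 0. The auxiliary [f] is minus twice this product. *)
Lemma cosh_le_expR (R : realType) (x : R) : 0 <= x ->
  (expR x + expR (- x)) / 2 <= expR (x ^+ 2 / 2).
Proof.
move=> x_ge0.
pose f (y : R) := - ((expR y + expR (- y)) * expR (- (y ^+ 2 / 2))).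
have df y : is_derive (y : R) (1 : R) f (expR (- (y ^+ 2 / 2)) *
    (y * (expR y + expR (- y)) - (expR y - expR (- y)))).
  by apply: is_derive_eq; rewrite /GRing.scale /=; field.
have : f 0 <= f x.
  apply: (ger0_is_derive_le df) => // y y_ge0.
  by rewrite mulr_ge0 ?expR_ge0 // subr_ge0 sinh_le_mul_cosh.
rewrite /f expr0n /= mul0r oppr0 expR0 mulr1 lerN2 => le2.
by rewrite ler_pdivrMr // -[leRHS]mulrC -ler_pdivrMr ?expR_gt0 // -expRN.
Qed.

(** Convexity of the exponential: [c * y] is the mean of [c] and [- c] with weights [(1 + y) / 2]
    and [(1 - y) / 2]. *)
Lemma expR_le_chord (R : realType) (c y : R) : `|y| <= 1 ->
  expR (c * y) <= (1 + y) / 2 * expR c + (1 - y) / 2 * expR (- c).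
Proof.
rewrite ler_norml => /andP[yge yle].
have t01 : 0 <= (1 + y) / 2 <= 1 by apply/andP; split; lra.
have := @convex_expR R (Itv01 (proj1 (andP t01)) (proj2 (andP t01))) c (- c).
rewrite !convRE /= /unstable.onem.
by congr (expR _ <= _); [field|congr (_ * _ + _ * _); field].
Qed.

Lemma hoeffding_lemma (R : realType) (I : finType) (p g : I -> R) (c : R) :
  is_dist p -> (forall i, `|g i| <= 1) -> \sum_i p i * g i = 0 -> 0 <= c ->
  \sum_i p i * expR (c * g i) <= expR (c ^+ 2 / 2).
Proof.
move=> [p_ge0 p_sum1] g_le1 g_mean0 c_ge0; apply: le_trans (cosh_le_expR c_ge0).
(* These are [cosh c] and [sinh c]. The chord at [y] is [u + y * v], affine in [y], so the zero mean
   of [g] leaves only [u]. *)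
pose u := (expR c + expR (- c)) / 2; pose v := (expR c - expR (- c)) / 2.
apply: (@le_trans _ _ (\sum_i (p i * u + p i * g i * v))); last first.
  by rewrite big_split /= -!mulr_suml p_sum1 g_mean0 mul1r mul0r addr0.
apply: ler_sum => i _; rewrite -mulrA -mulrDr ler_wpM2l //.
by apply: le_trans (expR_le_chord c (g_le1 i)) _; rewrite /u /v; lra.
Qed.

(** * Measurability of maps with discrete values, and sums over fibers *)

(** Measurability for the power-set sigma-algebra on [U], stated directly so that finite types and
    sequences need no measurable structure. *)
Definition discrete_measurable d (T : measurableType d) (U : Type)
  (f : T -> U) : Prop := forall B : set U, measurable (f @^-1` B).

Lemma discrete_measurable1 d (T : measurableType d) (U : countType)
  (f : T -> U) :
  (forall y, measurable (f @^-1` [set y])) -> discrete_measurable f.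
Proof.
move=> mf B; 
rewrite (_ : f @^-1` B =
  \bigcup_i (if `[< B i >] then f @^-1` [set i] else set0)); last first.
  apply/seteqP; split=> w /=.
    by move=> Bw; exists (f w) => //; case: asboolP.
  by move=> [y _]; case: asboolP => // + ->.
apply: countable_bigcupT_measurable; first exact: countableP.
by move=> y; case: ifP.
Qed.

Lemma discrete_measurable_comp d (T : measurableType d) (U V : Type)
  (g : U -> V) (f : T -> U) :
  discrete_measurable f -> discrete_measurable (g \o f).
Proof. by move=> mf B; rewrite comp_preimage; exact: mf. Qed.

Lemma discrete_measurable_pair d (T : measurableType d) (U V : countType)
  (f : T -> U) (g : T -> V) :
  discrete_measurable f -> discrete_measurable g ->
  discrete_measurable (fun w => (f w, g w)).
Proof.
move=> mf mg; apply: discrete_measurable1 => -[y z].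
rewrite (_ : _ @^-1` _ = (f @^-1` [set y]) `&` (g @^-1` [set z])).
  exact: measurableI.
by apply/seteqP; split=> w /= => [[-> ->]|[-> ->]].
Qed.

Lemma discrete_measurable_map d (T : measurableType d) (I : Type)
  (U : countType) (f : I -> T -> U) (s : seq I) :
  (forall i, discrete_measurable (f i)) ->
  discrete_measurable (fun w => [seq f i w | i <- s]).
Proof.
move=> mf; elim: s => [|i s IHs] /=.
  move=> B; have [B0|B0] := pselect (B [::]).
    by rewrite (_ : _ @^-1` _ = setT) //; apply/seteqP; split.
  by rewrite (_ : _ @^-1` _ = set0) //; apply/seteqP; split.
exact: (discrete_measurable_comp (fun p => p.1 :: p.2)
  (discrete_measurable_pair (mf i) IHs)).
Qed.

(** Serves to read a process at a random time: the event splits over the countably many values of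
    the index. *)
Lemma discrete_measurable_eval d (T : measurableType d) (I U : countType)
  (i : T -> I) (f : I -> T -> U) :
  discrete_measurable i -> (forall k, discrete_measurable (f k)) ->
  discrete_measurable (fun w => f (i w) w).
Proof.
move=> mi mf B.
rewrite (_ : _ @^-1` B = \bigcup_k ((i @^-1` [set k]) `&` (f k @^-1` B))).
  apply: countable_bigcupT_measurable; first exact: countableP.
  by move=> k; apply: measurableI; [exact: mi|exact: mf].
apply/seteqP; split=> w /=; first by move=> Bw; exists (i w).
by move=> [k _] /= [-> ?].
Qed.

(** Such an [E] is the preimage of its own image under [f]. *)
Lemma measurable_determined d (T : measurableType d) (U : Type)
  (f : T -> U) (E : set T) : discrete_measurable f ->
  (forall v w, f v = f w -> E v -> E w) -> measurable E.
Proof.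
move=> mf Ef; rewrite (_ : E = f @^-1` (f @` E)); first exact: mf.
apply/seteqP; split=> w /=; first by exists w.
by move=> [v Ev /Ef]; apply.
Qed.

Lemma sum_fsbigT (I : finType) (V : nmodType) (F : I -> V) :
  \sum_i F i = \sum_(i \in [set: I]) F i.
Proof.
rewrite (fsbig_seq _ _ (index_enum_uniq I)); apply: eq_fsbigl.
by apply/seteqP; split=> i //= _; exact: mem_index_enum.
Qed.

Lemma measure_fiber d (T : measurableType d) (R : realType)
  (mu : {measure set T -> \bar R}) (I : finType) (f : T -> I) (E : set T) :
  measurable E -> discrete_measurable f ->
  mu E = (\sum_i mu (E `&` f @^-1` [set i]))%E.
Proof.
move=> mE mf; rewrite sum_fsbigT -measure_fin_bigcup; last 3 first.
- exact: finite_finset.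
- by move=> i j _ _ [w [[_ <-] [_ <-]]].
- by move=> i _; apply: measurableI => //; exact: mf.
by congr (mu _); apply/seteqP; split=> w /=; [exists (f w)|case=> ? _ []].
Qed.

Lemma measure_bigcup_fin_le d (T : measurableType d) (R : realType)
  (mu : {measure set T -> \bar R}) (I : finType) (F : I -> set T) (c : R) :
  (forall i, measurable (F i)) -> (forall i, mu (F i) <= c%:E)%E ->
  (mu (\bigcup_i F i) <= (#|I|%:R * c)%:E)%E.
Proof.
move=> mF Fc; apply: (@le_trans _ _ (\sum_i mu (F i))%E).
  rewrite sum_fsbigT; apply: content_sub_fsum => //.
    exact: finite_finset.
  by apply: fin_bigcup_measurable => //; exact: finite_finset.
apply: (@le_trans _ _ (\sum_(i : I) c%:E)%E).
  by apply: lee_sum => i _; exact: Fc.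
by rewrite sumEFin lee_fin sumr_const mulr_natl.
Qed.

(** * Trajectory probabilities and Markov's inequality for path supermartingales *)

Section Trajectories.
Context {R : realType} {S A Sb : finType} (M : mdp R S A) (phi : S -> Sb)
  (pi : policy R Sb A).
Context d (Omega : measurableType d) (P : probability Omega R)
  (st : nat -> Omega -> S) (ac : nat -> Omega -> A).
Hypothesis gen : generated_by M phi P st ac pi.

Definition path_prefix (t : nat) (w : Omega) : seq (S * A) :=
  [seq (st k w, ac k w) | k <- iota 0 t].

Lemma st_discrete_measurable t : discrete_measurable (st t).
Proof. exact: discrete_measurable1 (gen_measurable_st gen t). Qed.

Lemma ac_discrete_measurable t : discrete_measurable (ac t).
Proof. exact: discrete_measurable1 (gen_measurable_ac gen t). Qed.

Lemma path_prefix_discrete_measurable t : discrete_measurable (path_prefix t).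
Proof.
apply: discrete_measurable_map => k; apply: discrete_measurable_pair.
  exact: st_discrete_measurable.
exact: ac_discrete_measurable.
Qed.

Lemma path_prefix_eq t v w : path_prefix t v = path_prefix t w ->
  forall k, (k < t)%N -> st k v = st k w /\ ac k v = ac k w.
Proof.
move=> /eq_in_map eq_vw k kt.
have : k \in iota 0 t by rewrite mem_iota.
by move=> /eq_vw[-> ->].
Qed.

Lemma measurable_path_event t (E : set Omega) :
  (forall v w, (forall k, (k < t)%N -> st k v = st k w /\ ac k v = ac k w) ->
    E v -> E w) -> measurable E.
Proof.
move=> Et; apply: (measurable_determined (@path_prefix_discrete_measurable t)).
by move=> v w /path_prefix_eq; exact: Et.
Qed.

Lemma measurable_traj_event x u t : measurable (traj_event st ac x u t).
Proof.
apply: (@measurable_path_event t.+1) => v w eq_vw [xv uv].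
split=> k kt; first by rewrite -(eq_vw k _).1 ?xv.
by rewrite -(eq_vw k _).2 ?uv // ltnS ltnW.
Qed.

(** Trajectories are total sequences of which only a prefix matters. One more step overwrites the
    state at [t.+1] and, in [extend_acts], the action at [t]; later values stay arbitrary. *)
Definition extend_traj (x : nat -> S) (t : nat) (s : S) : nat -> S :=
  [eta x with t.+1 |-> s].

Definition extend_acts (u : nat -> A) (t : nat) (b : A) : nat -> A :=
  [eta u with t |-> b].

Lemma traj_event_extend x u t b s :
  traj_event st ac (extend_traj x t s) (extend_acts u t b) t.+1 =
  traj_event st ac x u t `&` ac t @^-1` [set b] `&` st t.+1 @^-1` [set s].
Proof.
rewrite /extend_traj /extend_acts.
apply/seteqP; split=> w /=.
  move=> [xw uw]; split; first split; first split.
  - by move=> k kt; rewrite xw ?(leqW kt) //= ltn_eqF.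
  - by move=> k kt; rewrite uw ?(leqW kt) //= ltn_eqF.
  - by rewrite uw //= eqxx.
  - by rewrite xw //= eqxx.
move=> [[[xw uw] bw] sw]; split=> k kt /=.
  by case: eqVneq => [->//|kt']; rewrite xw // -ltnS ltn_neqAle kt'.
by case: eqVneq => [->//|kt']; rewrite uw // ltn_neqAle kt'.
Qed.

(** The two product laws of [generated_by] are applied to the extended sequences, which agree with
    [x] and [u] on the past. *)
Lemma prob_traj_extend x u t b s :
  (P (traj_event st ac x u t `&` ac t @^-1` [set b]
      `&` st t.+1 @^-1` [set s]) =
   P (traj_event st ac x u t) *
   (policy_prob pi (abs_history phi x u t) (phi (x t)) b *
    mdp_trans M (x t) b s)%:E)%E.
Proof.
pose x' := extend_traj x t s; pose u' := extend_acts u t b.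
have := gen_state gen x' u' t; rewrite (gen_action gen).
have x'E k : (k <= t)%N -> x' k = x k.
  by move=> kt; rewrite /x' /extend_traj /= ltn_eqF.
have u'E k : (k < t)%N -> u' k = u k.
  by move=> kt; rewrite /u' /extend_acts /= ltn_eqF.
have -> : traj_event st ac x' u' t = traj_event st ac x u t.
  by apply/seteqP; split=> w [xw uw]; split=> k kt;
     rewrite ?xw ?uw ?x'E ?u'E.
have -> : abs_history phi x' u' t = abs_history phi x u t.
  by apply/eq_in_map => k; rewrite mem_iota => /= kt; rewrite x'E ?u'E // ltnW.
have x'S : x' t.+1 = s by rewrite /x' /extend_traj /= eqxx.
have u't : u' t = b by rewrite /u' /extend_acts /= eqxx.
by rewrite (x'E t) // x'S u't => ->; rewrite -muleA -EFinM.
Qed.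

(* The inequality psm_step is required for every action distribution q, so that
   Z is a supermartingale under any policy. *)
Record path_supermartingale (Z : (nat -> S) -> (nat -> A) -> nat -> R) : Prop :=
  PathSupermartingale {
    psm_ge0 : forall x u t, 0 <= Z x u t;
    psm_adapted : forall x u x' u' t, (forall k, (k <= t)%N -> x k = x' k) ->
      (forall k, (k < t)%N -> u k = u' k) -> Z x u t = Z x' u' t;
    psm_step : forall x u t (q : A -> R), is_dist q ->
      \sum_b q b * \sum_s mdp_trans M (x t) b s *
        Z (extend_traj x t s) (extend_acts u t b) t.+1 <= Z x u t }.

Definition path_value (Z : (nat -> S) -> (nat -> A) -> nat -> R) t w : R :=
  Z (st^~ w) (ac^~ w) t.

Section Maximal.
Variables (Z : (nat -> S) -> (nat -> A) -> nat -> R).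
Hypothesis Z_psm : path_supermartingale Z.
Variable (z : R).
Hypothesis z_gt0 : 0 < z.

Let event t := [set w | z <= path_value Z t w].

Lemma measurable_path_value_ge t : measurable (event t).
Proof.
apply: (@measurable_path_event t.+1) => v w eq_vw.
rewrite /event /path_value /=.
rewrite (psm_adapted Z_psm (x' := st^~ w) (u' := ac^~ w)) // => k kt.
  by have [] := eq_vw k kt.
by have [] := eq_vw k (ltnW kt).
Qed.

(** Markov's inequality given the path up to time [t], by induction on the number [k] of remaining
    steps. The event is split by the next action and state, the induction hypothesis bounds each
    continuation, and [psm_step] averages these bounds back to [Z x u t]. *)
Lemma prob_traj_path_value_ge k t x u :
  (P (traj_event st ac x u t `&` event (t + k)) <=
   P (traj_event st ac x u t) * (Z x u t / z)%:E)%E.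
Proof.
elim: k t x u => [|k IHk] t x u.
  (* On the trajectory event the value at time [t] is the constant [Z x u t]: either it reaches [z]
     and the ratio is at least 1, or the intersection is empty. *)
  rewrite addn0; have [zZ|Zz] := leP z (Z x u t).
    apply: (@le_trans _ _ (P (traj_event st ac x u t))).
      apply: le_measure; rewrite ?inE; last exact: subIsetl.
        apply: measurableI; first exact: measurable_traj_event.
        exact: measurable_path_value_ge.
      exact: measurable_traj_event.
  rewrite -[leLHS]mule1 lee_wpmul2l ?measure_ge0 // lee_fin.
  by rewrite ler_pdivlMr // mul1r.
rewrite (_ : _ `&` _ = set0).
  by rewrite measure0 mule_ge0 // lee_fin divr_ge0 ?(psm_ge0 Z_psm) // ltW.
apply/seteqP; split=> w //= -[[xw uw]]; rewrite /event /path_value /=.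
rewrite (psm_adapted Z_psm (x' := x) (u' := u)) //.
by rewrite leNgt Zz.
have mE : measurable (traj_event st ac x u t `&` event (t + k.+1)).
  apply: measurableI; first exact: measurable_traj_event.
  exact: measurable_path_value_ge.
rewrite (measure_fiber _ mE (ac_discrete_measurable t)).
pose q b := policy_prob pi (abs_history phi x u t) (phi (x t)) b.
apply: (@le_trans _ _ (\sum_b \sum_s P (traj_event st ac x u t) *
   (q b * (mdp_trans M (x t) b s *
      (Z (extend_traj x t s) (extend_acts u t b) t.+1 / z)))%:E)%E).
  apply: lee_sum => b _.
  rewrite (measure_fiber _ _ (st_discrete_measurable t.+1)); last first.
    by apply: measurableI => //; exact: ac_discrete_measurable.
  apply: lee_sum => s _.
  rewrite -addSnnS in mE *.
  have := IHk t.+1 (extend_traj x t s) (extend_acts u t b).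
  rewrite traj_event_extend prob_traj_extend -muleA -EFinM -mulrA.
  by congr (P _ <= _)%E; apply/seteqP; split=> w /=; tauto.
rewrite -(fineK (fin_num_measure P _ (measurable_traj_event x u t))).
under eq_bigr do under eq_bigr do rewrite -EFinM.
under eq_bigr do rewrite sumEFin.
rewrite sumEFin -EFinM lee_fin.
under eq_bigr do rewrite -mulr_sumr.
rewrite -mulr_sumr ler_wpM2l ?fine_ge0 ?measure_ge0 //.
rewrite ler_pdivlMr // mulr_suml; apply: le_trans (psm_step Z_psm x u t _).
  apply: ler_sum => b _; rewrite -mulr_sumr -mulrA mulr_suml.
  by under eq_bigr do rewrite -mulrA divfK ?gt_eqF //.
exact: policy_probP.
Qed.

Lemma prob_path_value_ge t (z0 : R) : 0 <= z0 ->
  (forall x u, Z x u 0 <= z0) -> (P (event t) <= (z0 / z)%:E)%E.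
Proof.
move=> z0_ge0 Z0; have mE := measurable_path_value_ge t.
(* The point [w0] only supplies some action sequence; a trajectory event at time 0 reads no
   action. *)
have [->|/set0P[w0 _]] := eqVneq (event t) set0.
  by rewrite measure0 lee_fin divr_ge0 // ltW.
have trajE s : traj_event st ac (fun=> s) (ac^~ w0) 0 = st 0 @^-1` [set s].
  apply/seteqP; split=> w /=; first by case=> ->.
  by move=> sw; split=> // -[].
have -> : ((z0 / z)%:E = \sum_s P (st 0 @^-1` [set s]) * (z0 / z)%:E)%E.
  rewrite -ge0_sume_distrl // -[LHS]mul1e -(probability_setT P).
  rewrite (measure_fiber P measurableT (st_discrete_measurable 0)).
  by under eq_bigr do rewrite setTI.
rewrite (measure_fiber _ mE (st_discrete_measurable 0)).
apply: lee_sum => s _; rewrite setIC -trajE.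
apply: le_trans (prob_traj_path_value_ge t 0 _ _) _.
by rewrite lee_wpmul2l // lee_fin ler_wpM2r // invr_ge0 ltW.
Qed.

End Maximal.
End Trajectories.

(** * The compensated score in real time *)

Section Score.
Context {R : realType} {S A Sb : finType} (M : mdp R S A) (phi : S -> Sb).
Variables (sb : Sb) (a : A) (n : nat).

Definition path_visit (x : nat -> S) (u : nat -> A) (t : nat) : bool :=
  (phi (x t) == sb) && (u t == a).

(** The bound on earlier visits freezes the score after the first [n] visits. Whether step [t]
    counts is known once the action at [t] is chosen, before the next state is drawn. *)
Definition path_counted (x : nat -> S) (u : nat -> A) (t : nat) : bool :=
  path_visit x u t && (\sum_(k < t) path_visit x u k < n)%N.

Definition path_score (f : S -> S -> R) (x : nat -> S) (u : nat -> A)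
    (t : nat) : R :=
  \sum_(k < t) (if path_counted x u k then f (x k) (x k.+1) else 0).

Lemma path_counted_adapted x u x' u' t :
  (forall k, (k <= t)%N -> x k = x' k) ->
  (forall k, (k <= t)%N -> u k = u' k) ->
  path_counted x u t = path_counted x' u' t.
Proof.
move=> xx' uu'; rewrite /path_counted /path_visit xx' // uu' //.
congr (_ && (_ < _)%N); apply: eq_bigr => k _.
by rewrite xx' ?uu' // ltnW.
Qed.

Lemma path_score_adapted f x u x' u' t :
  (forall k, (k <= t)%N -> x k = x' k) ->
  (forall k, (k < t)%N -> u k = u' k) ->
  path_score f x u t = path_score f x' u' t.
Proof.
move=> xx' uu'; apply: eq_bigr => k _.
rewrite (@path_counted_adapted x u x' u') => [|j jk|j jk].
- by rewrite xx' ?xx' // ltnW.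
- by rewrite xx' // (leq_trans jk) // ltnW.
- by rewrite uu' // (leq_ltn_trans jk).
Qed.

Lemma path_score_extend f x u t b s :
  path_score f (extend_traj x t s) (extend_acts u t b) t.+1 =
  path_score f x u t +
    (if path_counted x (extend_acts u t b) t then f (x t) s else 0).
Proof.
rewrite {1}/path_score big_ord_recr /=.
have xE k : (k <= t)%N -> extend_traj x t s k = x k.
  by move=> kt; rewrite /extend_traj /= ltn_eqF.
have uE k : (k < t)%N -> extend_acts u t b k = u k.
  by move=> kt; rewrite /extend_acts /= ltn_eqF.
congr (_ + _); first exact: path_score_adapted.
rewrite (path_counted_adapted (x' := x) (u' := extend_acts u t b)) //.
by rewrite xE // {1}/extend_traj /= eqxx.
Qed.

(** A counted step multiplies the value by [expR (c * g s s' - c ^+ 2 / 2)], whose conditional mean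
    is at most 1 by Hoeffding's lemma. *)
Lemma expR_path_score_psm (g : S -> S -> R) (c : R) : 0 <= c ->
  (forall s s', `|g s s'| <= 1) ->
  (forall s, \sum_s' mdp_trans M s a s' * g s s' = 0) ->
  path_supermartingale M
    (fun x u t =>
      expR (path_score (fun s s' => c * g s s' - c ^+ 2 / 2) x u t)).
Proof.
move=> c_ge0 g_le1 g_mean0.
split => [x u t|x u x' u' t xx' uu'|x u t q [q_ge0 q_sum1]].
- exact: expR_ge0.
- by rewrite (path_score_adapted _ xx' uu').
set f := fun s s' : S => c * g s s' - c ^+ 2 / 2.
set z := expR (path_score f x u t).
(* Writing the right-hand side as a [q]-average reduces the claim to each single action [b]. *)
rewrite -[leRHS]mul1r -q_sum1 mulr_suml; apply: ler_sum => b _.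
rewrite ler_wpM2l //.
have stepE s : expR (path_score f (extend_traj x t s) (extend_acts u t b) t.+1)
    = z * expR (if path_counted x (extend_acts u t b) t then f (x t) s else 0).
  by rewrite path_score_extend expRD.
under eq_bigr do rewrite stepE mulrCA.
rewrite -mulr_sumr -[leRHS]mulr1 ler_wpM2l ?expR_ge0 //.
have [T_ge0 T_sum1] := mdp_transP M (x t) b.
(* A counted step takes action [a], so [g_mean0] applies; any other step leaves the value
   unchanged. *)
have [/andP[/andP[_ +] _]|_] := boolP (path_counted _ _ _); last first.
  by rewrite expR0; under eq_bigr do rewrite mulr1; rewrite T_sum1.
rewrite /extend_acts /= eqxx => /eqP bE; rewrite bE in T_ge0 T_sum1 *.
under eq_bigr do rewrite expRD mulrA.
rewrite -mulr_suml expRN ler_pdivrMr ?expR_gt0 // mul1r.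
exact: hoeffding_lemma (g_le1 _) (g_mean0 _) c_ge0.
Qed.

End Score.

(** * From real time to visit numbers, and the L1 distance as a sum of increments *)

Section Visits.
Context {R : realType} {S A Sb : finType} (M : mdp R S A) (phi : S -> Sb).
Context d (Omega : measurableType d)
  (st : nat -> Omega -> S) (ac : nat -> Omega -> A).
Variables (sb : Sb) (a : A).

Local Notation visit := (visit phi st ac sb a).
Local Notation nvisits := (nvisits phi st ac sb a).
Local Notation visit_time := (visit_time phi st ac sb a).
Local Notation visit_state := (visit_state phi st ac sb a).
Local Notation visit_next := (visit_next phi st ac sb a).

Lemma nvisitsS t w : nvisits t.+1 w = (nvisits t w + visit t w)%N.
Proof. by rewrite /Defs.nvisits big_ord_recr. Qed.

Lemma nvisits0 w : nvisits 0 w = 0%N.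
Proof. by rewrite /Defs.nvisits big_ord0. Qed.

Lemma nvisits_homo w : {homo nvisits^~ w : s t / (s <= t)%N}.
Proof.
apply: homo_leq => [//|? ? ?|t]; first exact: leq_trans.
by rewrite nvisitsS leq_addr.
Qed.

(** The counter increases strictly just after each visit, so two distinct visits never see the same
    count. *)
Lemma nvisits_inj s t w : visit s w -> visit t w ->
  nvisits s w = nvisits t w -> s = t.
Proof.
have lt_nvisits i j : visit i w -> (i < j)%N -> (nvisits i w < nvisits j w)%N.
  by move=> vi /(nvisits_homo w); rewrite nvisitsS vi addn1.
move=> vs vt eq_st; case: (ltngtP s t) => //.
  by move=> /(lt_nvisits _ _ vs); rewrite eq_st ltnn.
by move=> /(lt_nvisits _ _ vt); rewrite eq_st ltnn.
Qed.

Lemma visit_time_nvisits t w : visit t w -> visit_time (nvisits t w) w = t.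
Proof.
by move=> vt; apply: xget_unique => // s [vs]; exact: nvisits_inj.
Qed.

(** Once the counter exceeds [i], [visit_time i w] is a genuine visit and not the default 0. *)
Lemma visit_visit_time i t w : (i < nvisits t w)%N -> visit (visit_time i w) w.
Proof.
elim: t => [|t IHt]; first by rewrite nvisits0.
rewrite nvisitsS; have [vt|_] := boolP (visit t w); last by rewrite addn0.
rewrite addn1 ltnS leq_eqVlt => /predU1P[->|//].
by rewrite visit_time_nvisits.
Qed.

(** A counted step at time [t] is visit number [nvisits t w], so it appends exactly the next term of
    the sum over visits. *)
Lemma path_score_visits (n : nat) (f : S -> S -> R) t w :
  path_score phi sb a n f (st^~ w) (ac^~ w) t =
  \sum_(i < minn n (nvisits t w))
    f (visit_state i w) (st (visit_time i w).+1 w).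
Proof.
elim: t => [|t IHt].
  by rewrite /path_score nvisits0 minn0 !big_ord0.
rewrite /path_score big_ord_recr /= -/(path_score _ _ _ _ _ _ _ _) IHt.
have -> : path_counted phi sb a n (st^~ w) (ac^~ w) t =
  visit t w && (nvisits t w < n)%N by [].
rewrite nvisitsS.
have [vt|_] /= := boolP (visit t w); last by rewrite addn0 addr0.
case: ltnP => [lt_tn|le_nt]; last by rewrite addr0 (minn_idPl _) // addn1 leqW.
rewrite addn1 (minn_idPr lt_tn) big_ord_recr /=.
by rewrite /Defs.visit_state visit_time_nvisits.
Qed.

Hypothesis st_meas : forall t, discrete_measurable (st t).
Hypothesis visits_meas : forall t i,
  measurable [set w | visit t w /\ nvisits t w = i].

Lemma visit_time_discrete_measurable i : discrete_measurable (visit_time i).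
Proof.
apply: discrete_measurable1 => t.
pose V k := [set w | visit k w /\ nvisits k w = i].
(* The value 0 is also the default, so its fiber contains the paths on which visit [i] never
   happens. *)
rewrite (_ : _ @^-1` _ = V t `|`
    (if t == 0%N then \bigcap_k ~` V k else set0)).
  apply: measurableU; first exact: visits_meas.
  case: ifP => // _; apply: bigcap_measurable; first by exists 0%N.
  by move=> k _; apply: measurableC; exact: visits_meas.
apply/seteqP; split=> w /=.
  rewrite /Defs.visit_time; case: xgetP => [k -> Vk <-|noV <-]; first by left.
  by right; rewrite eqxx => k _; exact: noV.
case=> [[vt <-]|]; first exact: visit_time_nvisits.
case: eqP => // -> noV.
by apply: xgetPN => k Vk; exact: (noV k).
Qed.

Lemma visit_state_discrete_measurable i : discrete_measurable (visit_state i).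
Proof.
exact: discrete_measurable_eval (visit_time_discrete_measurable i) st_meas.
Qed.

Lemma visit_next_discrete_measurable i : discrete_measurable (visit_next i).
Proof.
apply: (discrete_measurable_comp phi).
exact: discrete_measurable_eval (visit_time_discrete_measurable i)
  (fun t => st_meas t.+1).
Qed.

Lemma sum_emp_trans (n : nat) (h : Sb -> R) w :
  \sum_sb' h sb' * emp_trans phi st ac sb a n w sb' =
  n%:R^-1 * \sum_(i < n) h (visit_next i w).
Proof.
rewrite /emp_trans.
under eq_bigr do rewrite mulrCA mulr_sumr.
rewrite -mulr_sumr exchange_big /=; congr (_ * _); apply: eq_bigr => i _.
rewrite (bigD1 (visit_next i w)) //= eqxx mulr1 big1 ?addr0 // => y.
by rewrite eq_sym => /negPf->; rewrite mulr0.
Qed.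

(** [weighted_trans] sums only over the states of [sb]; the hypothesis ensures that no sampled state
    falls outside this sum. *)
Lemma sum_weighted_trans (n : nat) (h : Sb -> R) w :
  (forall i : 'I_n, phi (visit_state i w) = sb) ->
  \sum_sb' h sb' * weighted_trans M phi st ac sb a n w sb' =
  n%:R^-1 * \sum_(i < n) \sum_sb'
    h sb' * abs_trans M phi sb' (visit_state i w) a.
Proof.
move=> phiX; rewrite exchange_big mulr_sumr; apply: eq_bigr => y _ /=.
rewrite -mulr_sumr mulrCA; congr (_ * _).
rewrite /weighted_trans /emp_weight.
under eq_bigr do rewrite -mulrA mulr_suml.
rewrite -mulr_sumr exchange_big /=; congr (_ * _); apply: eq_bigr => i _.
rewrite (bigD1 (visit_state i w)) ?phiX //= eqxx mul1r big1 ?addr0 // => s.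
by move=> /andP[_]; rewrite eq_sym => /negPf->; rewrite mul0r.
Qed.

Lemma sum_abs_trans (h : Sb -> R) s :
  \sum_sb' h sb' * abs_trans M phi sb' s a =
  \sum_s' mdp_trans M s a s' * h (phi s').
Proof.
rewrite [RHS](partition_big phi xpredT) //=; apply: eq_bigr => y _.
rewrite /abs_trans mulr_sumr; apply: eq_bigr => s' /eqP ->.
by rewrite mulrC.
Qed.

(* The division by 2 brings the martingale difference into [-1, 1]. *)
Definition increment (h : Sb -> R) (s s' : S) : R :=
  (h (phi s') - \sum_sb' h sb' * abs_trans M phi sb' s a) / 2.

Lemma increment_mean h s :
  \sum_s' mdp_trans M s a s' * increment h s s' = 0.
Proof.
have [_ T_sum1] := mdp_transP M s a.
under eq_bigr do rewrite /increment mulrA mulrBr.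
by rewrite -mulr_suml sumrB -mulr_suml T_sum1 mul1r sum_abs_trans subrr mul0r.
Qed.

Lemma increment_le1 h s s' : (forall y, `|h y| <= 1) ->
  `|increment h s s'| <= 1.
Proof.
have [T_ge0 T_sum1] := mdp_transP M s a.
move=> h_le1; rewrite /increment sum_abs_trans normrM.
rewrite [X in _ * X]ger0_norm ?invr_ge0 // ler_pdivrMr // mul1r.
apply: (le_trans (ler_normB _ _)); rewrite -[leRHS]/(1 + 1).
apply: lerD => //; apply: le_trans (ler_norm_sum _ _ _) _; rewrite -T_sum1.
apply: ler_sum => r _; rewrite normrM (ger0_norm (T_ge0 r)) -[leRHS]mulr1.
by rewrite ler_wpM2l.
Qed.

Lemma l1_dist_increments (n : nat) t w : (n <= nvisits t w)%N ->
  exists h : {ffun Sb -> bool},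
    l1_dist (emp_trans phi st ac sb a n w)
            (weighted_trans M phi st ac sb a n w) =
    2 / n%:R * \sum_(i < n) increment (fun y => (-1) ^+ h y) (visit_state i w)
                 (st (visit_time i w).+1 w).
Proof.
move=> le_nt.
(* The sign is -1 exactly where the difference is negative, so multiplying by it gives the absolute
   value. *)
pose e := [ffun y => emp_trans phi st ac sb a n w y -
                     weighted_trans M phi st ac sb a n w y < 0].
exists e; pose h y : R := (-1) ^+ e y; rewrite /l1_dist.
transitivity (\sum_y (h y * emp_trans phi st ac sb a n w y -
                      h y * weighted_trans M phi st ac sb a n w y)).
  by apply: eq_bigr => y _; rewrite -mulrBr normrEsign /h ffunE.
rewrite sumrB sum_emp_trans sum_weighted_trans; last first.
  move=> i; have lt_it := leq_trans (ltn_ord i) le_nt.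
  by have /andP[/eqP] := visit_visit_time lt_it.
rewrite -mulrBr -sumrB /increment -mulr_suml.
by rewrite [RHS]mulrC mulrA divfK ?pnatr_eq0 // mulrC.
Qed.

End Visits.

(** * Union bound over sign vectors and passage to infinite time *)

Lemma natr_card_ffun_bool (R : realType) (I : finType) :
  #|{ffun I -> bool}|%:R = 2 ^+ #|I| :> R.
Proof. by rewrite card_ffun card_bool natrX. Qed.

Theorem theorem2 (R : realType) (S A Sb : finType) (M : mdp R S A)
  (phi : S -> Sb) (phi_surj : set_surj [set: S] [set: Sb] phi)
  (pi : policy R Sb A)
  (d : measure_display) (Omega : measurableType d) (P : probability Omega R)
  (st : nat -> Omega -> S) (ac : nat -> Omega -> A)
  (gen : generated_by M phi P st ac pi)
  (sb : Sb) (a : A) (n : nat) (n_ge1 : (1 <= n)%N)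
  (visits_occur :
    {ae P, forall w, exists t : nat, (n <= nvisits phi st ac sb a t w)%N})
  (eps : R) (eps_gt0 : 0 < eps) :
  ((1 - 2 ^+ #|Sb| * expR (- (8^-1 * n%:R * eps ^+ 2)))%:E <=
   P [set w | (l1_dist (emp_trans phi st ac sb a n w)
                       (weighted_trans M phi st ac sb a n w) <= eps)%R])%E.
Proof.
set good := [set w | _]; set delta := expR _.
have st_meas := st_discrete_measurable gen.
have visits_meas t i : measurable
    [set w | visit phi st ac sb a t w /\ nvisits phi st ac sb a t w = i].
  apply: (measurable_path_event gen (t := t.+1)) => v w eq_vw /= [vt <-].
  have vE k : (k <= t)%N -> visit phi st ac sb a k w = visit phi st ac sb a k v.
    by move=> kt; rewrite /visit; have [-> ->] := eq_vw k kt.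
  split; first by rewrite vE.
  by apply: eq_bigr => k _; rewrite vE // ltnW.
have nvisits_meas t : measurable [set w | (n <= nvisits phi st ac sb a t w)%N].
  apply: (measurable_path_event gen (t := t)) => v w eq_vw /=.
  suff -> : nvisits phi st ac sb a t v = nvisits phi st ac sb a t w by [].
  by apply: eq_bigr => k _; rewrite /visit; have [-> ->] := eq_vw k (ltn_ord k).
have good_meas : measurable good.
  (* The event [good] depends on the path only through these [n] pairs, which take countably many
     values. *)
  pose samples w := [seq (visit_state phi st ac sb a i w,
                          visit_next phi st ac sb a i w) | i <- iota 0 n].
  have samples_meas : discrete_measurable samples.
    apply: discrete_measurable_map => i; apply: discrete_measurable_pair.
      exact: visit_state_discrete_measurable.
    exact: visit_next_discrete_measurable.
  apply: (measurable_determined samples_meas) => v w /eq_in_map eq_vw.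
  have sampleE (i : 'I_n) :
      (visit_state phi st ac sb a i v, visit_next phi st ac sb a i v) =
      (visit_state phi st ac sb a i w, visit_next phi st ac sb a i w).
    by apply: eq_vw; rewrite mem_iota /=.
  rewrite /good /=; congr (l1_dist _ _ <= _); apply: funext => y.
    by congr (_ * _); apply: eq_bigr => i _; have [_ ->] := sampleE i.
  apply: eq_bigr => s _; congr (_ * _ * _); apply: eq_bigr => i _.
  by have [-> _] := sampleE i.
(* Failures for which all [n] visits have occurred before time [t]: there the score at time [t]
   contains every sampled increment. *)
pose bad t := ~` good `&` [set w | (n <= nvisits phi st ac sb a t w)%N].
have bad_meas t : measurable (bad t).
  by apply: measurableI => //; exact: measurableC.
have bad_le t : (P (bad t) <= (2 ^+ #|Sb| * delta)%:E)%E.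
  (* The exponent of Z h is c X - n c^2 / 2 with X the sum of the increments,
     and X > n eps / 2 on the bad event; c = eps / 2 gives the bound z. *)
  pose f (h : {ffun Sb -> bool}) s s' :=
    eps / 2 * increment M phi a (fun y => (-1) ^+ h y) s s' -
    (eps / 2) ^+ 2 / 2.
  pose Z h x u t := expR (path_score phi sb a n (f h) x u t).
  pose z := expR (8^-1 * n%:R * eps ^+ 2).
  have Z_psm h : path_supermartingale M (Z h).
    apply: expR_path_score_psm; first by rewrite divr_ge0 // ltW.
      by move=> s s'; apply: increment_le1 => y; rewrite normr_sign.
    exact: increment_mean.
  pose event h := [set w | z <= path_value st ac (Z h) t w].
  have event_meas h : measurable (event h).
    exact: measurable_path_value_ge gen _ (Z_psm h) _ _.
  have event_le h : (P (event h) <= delta%:E)%E.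
    apply: le_trans (prob_path_value_ge gen (Z_psm h) (expR_gt0 _) t ler01 _) _.
      by move=> x u; rewrite /Z /path_score big_ord0 expR0.
    by rewrite mul1r -expRN.
  rewrite -natr_card_ffun_bool.
  apply: le_trans (measure_bigcup_fin_le event_meas event_le).
  apply: le_measure; rewrite ?inE //.
    by apply: fin_bigcup_measurable => //; exact: finite_finset.
  move=> w [/= /negP]; rewrite -ltNge => eps_lt le_nt.
  have [h hE] := l1_dist_increments M le_nt; exists h => //.
  rewrite /event /path_value /Z /= ler_expR path_score_visits (minn_idPl le_nt).
  rewrite hE in eps_lt; rewrite /f sumrB -mulr_sumr sumr_const card_ord.
  have n_gt0 : 0 < n%:R :> R by rewrite ltr0n.
  move: eps_lt; rewrite mulrAC ltr_pdivlMr // -mulr_natl.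
  by move: (\sum_(i < n) _) => X; nra.
(* The events [bad t] grow with [t], since visit counts do, and their bound does not depend on [t];
   continuity from below carries it to the union. *)
have bad_cup_le : (P (\bigcup_t bad t) <= (2 ^+ #|Sb| * delta)%:E)%E.
  have bad_cvg : (P \o bad) x @[x --> \oo] --> P (\bigcup_t bad t).
    apply: nondecreasing_cvg_mu => //; first exact: bigcupT_measurable.
    move=> s t st_le; apply/subsetPset => w [gw nw]; split => //=.
    exact: leq_trans nw (nvisits_homo phi st ac sb a w st_le).
  rewrite -(cvg_lim _ bad_cvg) //; apply: lime_le.
    by apply/cvg_ex; exists (P (\bigcup_t bad t)).
  by apply: nearW => t; exact: bad_le.
have [N [N_meas PN0 subN]] := visits_occur.
(* Outside the null set [N] the [n] visits are complete at some finite time, so every failure there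
   lies in some [bad t]. *)
have badC_le : (P (~` good) <= (2 ^+ #|Sb| * delta)%:E)%E.
  apply: le_trans bad_cup_le.
  rewrite -[leRHS](measureU0 _ N_meas PN0); last exact: bigcupT_measurable.
  apply: le_measure; rewrite ?inE //; first exact: measurableC.
    by apply: measurableU => //; exact: bigcupT_measurable.
  move=> w badw; have [[t nt]|no] := pselect
      (exists t, (n <= nvisits phi st ac sb a t w)%N).
    by left; exists t.
  by right; exact: subN.
have fin_good := fin_num_measure P _ good_meas.
move: badC_le; rewrite probability_setC // -(fineK fin_good) -EFinB !lee_fin.
by lra.
Qed.
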